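(* Let $I\subset\mathbb{R}$ be an open interval, $m:I\to(0,\infty)$ a smooth function, and $M\to\mathbb{R}^3$ the surface of revolution $(u,v)\mapsto(m(u)\cos v,\,m(u)\sin v,\,u)$, $u\in I$, $v\in\mathbb{S}^1$. Then $M$ admits a strongly convex slope metric $$F=\frac{\alpha^2}{\alpha-\beta},\qquad \alpha=\sqrt{\left[1+(m'(u))^2\right]\dot u^2+m(u)^2\dot v^2},\qquad \beta=\dot u,$$ if and only if $$(m'(u))^2>3\quad\text{for all }u\in I.$$ Moreover, $(M,F)$ is a Finsler surface of revolution.
   Context: Here $(u,v,\dot u,\dot v)$ are the canonical coordinates on $TM$. The slope metric $F$ of $M$ is strongly convex if $F$ is a positive, well-defined function on all nonzero tangent vectors ($\alpha>\beta$) and its Hessian $g_{ij}=\frac12\frac{\partial^2F^2}{\partial y^i\partial y^j}$, with $(y^1,y^2)=(\dot u,\dot v)$, is positive definite at every nonzero tangent vector of $M$. A Finsler structure on a surface of revolution is called a Finsler surface of revolution if $\partial/\partial v$ is a Killing vector field for $F$, i.e. $\frac{\partial F}{\partial v}=0$. *)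

(* Defs.v *)
From Stdlib Require Export Reals Lra.
From Coquelicot Require Export Coquelicot.
Open Scope R_scope.

(** * Directional derivatives and smoothness of functions of several variables *)

Definition partial {V : NormedModule R_AbsRing} (e : V) (f : V -> R) (p : V) : R :=
  Derive (fun t : R => f (plus p (scal t e))) 0.

Definition ex_partial {V : NormedModule R_AbsRing} (e : V) (f : V -> R) (p : V) : Prop :=
  ex_derive (fun t : R => f (plus p (scal t e))) 0.

(** For [D] open and [V] finite-dimensional this is C^n on [D]: continuity of
    the lower-order derivatives follows from that of the partials. *)
Fixpoint C_n {V : NormedModule R_AbsRing} (n : nat) (D : V -> Prop) (f : V -> R) : Prop :=
  match n with
  | O => forall p, D p -> continuous f p
  | S k => forall e : V,
      (forall p, D p -> ex_partial e f p) /\ C_n k D (partial e f)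
  end.

Definition smooth_on {V : NormedModule R_AbsRing} (D : V -> Prop) (f : V -> R) : Prop :=
  forall n : nat, C_n n D f.

Definition smooth_on_R (I : R -> Prop) (m : R -> R) : Prop :=
  forall (n : nat) (u : R), I u -> ex_derive_n m n u.

Definition open_itv (a b : Rbar) (u : R) : Prop := Rbar_lt a u /\ Rbar_lt u b.

(** * The surface of revolution and its tangent bundle

    [M] is [I * S^1].  A tangent vector is given by its canonical coordinates
    [((u, v), (du, dv))], where the angle [v] is a real number taken modulo
    [2 * PI]; a function on [TM] is a function of these coordinates that is
    [2 * PI]-periodic in [v]. *)

Definition TM : Type := ((R * R) * (R * R))%type.

Definition in_TM (I : R -> Prop) (p : TM) : Prop := I (fst (fst p)).

Definition slit_TM (I : R -> Prop) (p : TM) : Prop :=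
  in_TM I p /\ snd p <> (0, 0).

Definition periodic_in_v (I : R -> Prop) (F : TM -> R) : Prop :=
  forall u v du dv, I u -> F ((u, v + 2 * PI), (du, dv)) = F ((u, v), (du, dv)).

Definition e_v : TM := ((0, 1), (0, 0)).
Definition e_y1 : TM := ((0, 0), (1, 0)).
Definition e_y2 : TM := ((0, 0), (0, 1)).

(** * Finsler structures *)

Definition fundamental_tensor (F : TM -> R) (ei ej : TM) (p : TM) : R :=
  / 2 * partial ei (partial ej (fun q => F q ^ 2)) p.

Definition positive_definite_hessian (F : TM -> R) (p : TM) : Prop :=
  forall w1 w2 : R, (w1, w2) <> (0, 0) ->
    0 < fundamental_tensor F e_y1 e_y1 p * w1 * w1
      + fundamental_tensor F e_y1 e_y2 p * w1 * w2
      + fundamental_tensor F e_y2 e_y1 p * w2 * w1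
      + fundamental_tensor F e_y2 e_y2 p * w2 * w2.

Definition strongly_convex (I : R -> Prop) (F : TM -> R) : Prop :=
  forall p, slit_TM I p -> 0 < F p /\ positive_definite_hessian F p.

(** Homogeneity is also required at zero vectors, where it forces [F = 0]. *)
Definition finsler_structure (I : R -> Prop) (F : TM -> R) : Prop :=
  periodic_in_v I F /\
  smooth_on (slit_TM I) F /\
  (forall (x y : R * R) (l : R), in_TM I (x, y) -> 0 < l ->
     F (x, scal l y) = l * F (x, y)) /\
  strongly_convex I F.

Definition killing_d_dv (I : R -> Prop) (F : TM -> R) : Prop :=
  forall p, in_TM I p -> ex_partial e_v F p /\ partial e_v F p = 0.

Definition finsler_surface_of_revolution (I : R -> Prop) (F : TM -> R) : Prop :=
  finsler_structure I F /\ killing_d_dv I F.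

(** * The slope metric *)

Definition alpha (m : R -> R) (p : TM) : R :=
  let '((u, v), (du, dv)) := p in
  sqrt ((1 + Derive m u ^ 2) * du ^ 2 + m u ^ 2 * dv ^ 2).

Definition beta (p : TM) : R :=
  let '((u, v), (du, dv)) := p in du.

Definition slope_metric (m : R -> R) (p : TM) : R :=
  alpha m p ^ 2 / (alpha m p - beta p).

(** The condition [beta < alpha] is what makes the quotient well defined; it
    also makes the metric smooth off the zero section, so that the total
    operator [Derive] in the Hessian computes actual derivatives. *)
Definition strongly_convex_slope_metric (I : R -> Prop) (m : R -> R) : Prop :=
  (forall p, slit_TM I p -> beta p < alpha m p) /\
  strongly_convex I (slope_metric m).

(** [alpha] is the norm induced on [M] by the immersion into Euclidean
    3-space, and [beta] is the differential of its height. *)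

Definition surf_x (m : R -> R) (q : R * R) : R := m (fst q) * cos (snd q).
Definition surf_y (m : R -> R) (q : R * R) : R := m (fst q) * sin (snd q).
Definition surf_z (q : R * R) : R := fst q.

Lemma beta_height (q y : R * R) : beta (q, y) = partial y surf_z q.
Proof.
destruct q as [u v], y as [du dv].
symmetry; apply is_derive_unique.
unfold surf_z, plus, scal; simpl; unfold plus, scal, mult; simpl; unfold mult; simpl.
auto_derive; [easy | ring].
Qed.

Lemma alpha_induced (m : R -> R) (q y : R * R) : ex_derive m (fst q) ->
  alpha m (q, y) =
  sqrt (partial y (surf_x m) q ^ 2 + partial y (surf_y m) q ^ 2 + partial y surf_z q ^ 2).
Proof.
destruct q as [u v], y as [du dv]; simpl fst; intros Hm.
rewrite <- beta_height; simpl beta.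
assert (E : forall x z : R, x + 0 * z = x) by (intros; ring).
assert (Hx : partial (du, dv) (surf_x m) (u, v)
             = Derive m u * du * cos v - m u * sin v * dv).
{ apply is_derive_unique.
  unfold surf_x, plus, scal; simpl; unfold plus, scal, mult; simpl; unfold mult; simpl.
  auto_derive; rewrite ?E; [easy |].
  change (Derive (fun x => m x) u) with (Derive m u); ring. }
assert (Hy : partial (du, dv) (surf_y m) (u, v)
             = Derive m u * du * sin v + m u * cos v * dv).
{ apply is_derive_unique.
  unfold surf_y, plus, scal; simpl; unfold plus, scal, mult; simpl; unfold mult; simpl.
  auto_derive; rewrite ?E; [easy |].
  change (Derive (fun x => m x) u) with (Derive m u); ring. }
rewrite Hx, Hy; unfold alpha; f_equal.
assert (C : cos v ^ 2 = 1 - sin v ^ 2)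
  by (generalize (sin2_cos2 v); unfold Rsqr; simpl; lra).
ring_simplify; rewrite C; ring.
Qed.

(* Main.v *)
Require Import Defs.
From Corelib Require Import ssreflect.
Open Scope R_scope.

(** In a fibre, write [A = 1 + m'(u)^2], [B = m(u)^2], [(x, y)] for the tangent
    vector and [n = alpha = sqrt (A x^2 + B y^2)], so that [F = n^2 / (n - x)].

    As [F] is homogeneous of degree one in two variables, its Hessian annihilates
    [(x, y)], hence is a multiple of the square of the linear form
    [x w2 - y w1]; a computation gives
    [[
      F_ww = K (x w2 - y w1)^2,   K = B ((A + 2) n - 3 A x) / (n (n - x)^3).
    ]]
    Therefore the fundamental tensor is the sum of squares
    [[
      g(w, w) = (F_x w1 + F_y w2)^2 + F K (x w2 - y w1)^2
    ]]
    ([fundamental_tensor_sum_of_squares]).  The two linear forms are independent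
    by the identity [F_x x + F_y y = F] of Euler, so [g] is positive
    definite exactly when [K > 0].  Since [n >= sqrt A x], the worst direction is
    the meridian [(1, 0)], where [n = sqrt A] and the numerator of [K / B] becomes
    [sqrt A (sqrt A - 1) (sqrt A - 2)].  As [alpha > beta] says [sqrt A > 1], the
    condition is [A > 4], which is [m'(u)^2 > 3].

    For the Finsler structure, the remaining issue is smoothness off the zero
    section.  It comes from a class of functions ([elementary]) that is closed
    under partial derivatives and whose members are continuous: such functions
    are automatically smooth, and [F] is one of them. *)

(** * Functions closed under differentiation *)

Lemma ex_derive_n_Derive (f : R -> R) n z :
  ex_derive_n f (S n) z -> ex_derive_n (Derive f) n z.
Proof.
destruct n as [| n]; [easy |]; simpl; apply ex_derive_ext; intros t.
rewrite (Derive_n_comp f n 1); now replace (n + 1)%nat with (S n) by ring.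
Qed.

Section Smooth.
Context {V : NormedModule R_AbsRing}.
Implicit Types (D : V -> Prop) (f g : V -> R) (p e : V).

Lemma line_locally_in_open D p e :
  open D -> D p -> locally 0 (fun t : R => D (plus p (scal t e))).
Proof.
intros HD Hp.
assert (C : continuous (fun t : R => plus p (scal t e)) 0).
{ apply: continuous_plus; [apply continuous_const |].
  apply: continuous_scal_l; apply continuous_id. }
apply C.
assert (E : plus p (scal 0 e) = p) by (rewrite (scal_zero_l e); apply plus_zero_r).
rewrite E; apply HD, Hp.
Qed.

Lemma partial_ext_open D f g p e :
  open D -> D p -> (forall q, D q -> f q = g q) -> partial e f p = partial e g p.
Proof.
intros HD Hp Hfg; apply Derive_ext_loc.
generalize (line_locally_in_open D p e HD Hp); apply filter_imp; intros t; apply Hfg.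
Qed.

(** The clause of [C_n] for [n + 1] speaks of derivatives only, so an induction
    proving that [C_n] is closed under products would lack the continuity of the
    factors.  Here membership gives continuity, and the partial derivatives of a
    member agree on [D] with members again. *)
Inductive elementary D : (V -> R) -> Prop :=
| elementary_const c : elementary D (fun _ => c)
| elementary_linear (l : V -> R) : is_linear l -> elementary D l
| elementary_comp (phi : R -> R) f :
    (forall p n, D p -> ex_derive_n phi n (f p)) ->
    elementary D f -> elementary D (fun p => phi (f p))
| elementary_plus f g :
    elementary D f -> elementary D g -> elementary D (fun p => f p + g p)
| elementary_mult f g :
    elementary D f -> elementary D g -> elementary D (fun p => f p * g p)
| elementary_inv f :
    (forall p, D p -> f p <> 0) -> elementary D f -> elementary D (fun p => / f p)
| elementary_sqrt f :
    (forall p, D p -> 0 < f p) -> elementary D f -> elementary D (fun p => sqrt (f p)).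

Lemma elementary_continuous D f :
  elementary D f -> forall p, D p -> continuous f p.
Proof.
induction 1 as [c | l Hl | phi f Hphi _ IHf | f g _ IHf _ IHg
               | f g _ IHf _ IHg | f Hf _ IHf | f Hf _ IHf]; intros p Hp.
- apply continuous_const.
- apply: (linear_cont l p Hl).
- apply (continuous_comp f phi).
  + auto.
  + apply: ex_derive_continuous; exact (Hphi p 1%nat Hp).
- apply: continuous_plus; auto.
- apply: continuous_mult; auto.
- apply (continuous_comp f Rinv); [auto |].
  apply continuity_pt_filterlim, continuity_pt_inv; [| auto].
  apply continuity_pt_id.
- apply (continuous_comp f sqrt); [auto |]; apply continuous_sqrt.
Qed.

Lemma elementary_is_derive D f e :
  elementary D f ->
  exists g, elementary D g /\
    forall p, D p -> is_derive (fun t : R => f (plus p (scal t e))) 0 (g p).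
Proof.
assert (P0 : forall p, plus p (scal (0 : R) e) = p)
  by (intros p; rewrite (scal_zero_l e); apply plus_zero_r).
induction 1 as [c | l Hl | phi f Hphi Hf [f' [Hf' Df]] | f g Hf [f' [Hf' Df]] Hg [g' [Hg' Dg]]
               | f g Hf [f' [Hf' Df]] Hg [g' [Hg' Dg]]
               | f Hf0 Hf [f' [Hf' Df]] | f Hf0 Hf [f' [Hf' Df]]].
- exists (fun _ => 0); split; [constructor |]; intros p _; apply: is_derive_const.
- exists (fun _ => l e); split; [constructor |]; intros p _.
  apply (is_derive_ext (fun t => l p + t * l e)).
  { intros t; rewrite (linear_plus l Hl) (linear_scal l Hl); reflexivity. }
  auto_derive; [easy | ring].
- exists (fun p => f' p * Derive phi (f p)); split.
  + apply elementary_mult; [exact Hf' |].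
    apply (elementary_comp D (Derive phi)); [| exact Hf]; intros p n Hp.
    now apply ex_derive_n_Derive, Hphi.
  + intros p Hp; apply (is_derive_comp phi); [| auto].
    rewrite P0; apply Derive_correct; exact (Hphi p 1%nat Hp).
- exists (fun p => f' p + g' p); split; [now constructor |]; intros p Hp.
  apply: is_derive_plus; auto.
- exists (fun p => f' p * g p + f p * g' p); split.
  { apply elementary_plus; apply elementary_mult; assumption. }
  intros p Hp.
  generalize (is_derive_mult _ _ 0 _ _ (Df p Hp) (Dg p Hp) Rmult_comm).
  now rewrite !P0.
- exists (fun p => (-1) * f' p * (/ f p * / f p)); split.
  { apply elementary_mult; [now apply elementary_mult; [constructor |] |].
    now apply elementary_mult; apply elementary_inv. }
  intros p Hp.
  assert (E : -1 * f' p * (/ f p * / f p) = - f' p / f (plus p (scal 0 e)) ^ 2)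
    by (rewrite P0; field; auto).
  rewrite E; apply: is_derive_inv; [auto | rewrite P0; auto].
- exists (fun p => / 2 * f' p * / sqrt (f p)); split.
  { apply elementary_mult; [now apply elementary_mult; [constructor |] |].
    apply elementary_inv; [| now apply elementary_sqrt].
    intros p Hp; apply Rgt_not_eq, sqrt_lt_R0; auto. }
  intros p Hp.
  assert (S0 : sqrt (f p) <> 0) by (apply Rgt_not_eq, sqrt_lt_R0; auto).
  assert (E : / 2 * f' p * / sqrt (f p) = f' p * / (2 * sqrt (f (plus p (scal 0 e)))))
    by (rewrite P0; field; auto).
  rewrite E.
  apply (is_derive_comp sqrt); [apply is_derive_Reals, derivable_pt_lim_sqrt; rewrite P0 |]; auto.
Qed.

(** Equality with an elementary function is only asked on [D]; that is enough
    because [D] is open, and the induction needs it because the partial derivatives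
    are known to be elementary on [D] only. *)
Lemma elementary_smooth D f g :
  open D -> elementary D g -> (forall p, D p -> f p = g p) -> smooth_on D f.
Proof.
intros HD Hg Hfg n; revert f g Hg Hfg.
induction n as [| n IH]; intros f g Hg Hfg.
- intros p Hp; apply continuous_ext_loc with g.
  + generalize (HD p Hp); apply filter_imp; intros q Hq; symmetry; auto.
  + now apply elementary_continuous with D.
- intros e; destruct (elementary_is_derive D g e Hg) as [g' [Hg' Dg]].
  assert (Df : forall p, D p -> is_derive (fun t : R => f (plus p (scal t e))) 0 (g' p)).
  { intros p Hp; apply (is_derive_ext_loc (fun t : R => g (plus p (scal t e)))); [| auto].
    generalize (line_locally_in_open D p e HD Hp); apply filter_imp.
    intros t Ht; symmetry; auto. }
  split.
  + intros p Hp; exists (g' p); auto.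
  + apply (IH _ g' Hg'); intros p Hp; apply is_derive_unique; auto.
Qed.

End Smooth.

(** * Openness of the slit tangent bundle *)

Lemma open_open_itv (a b : Rbar) : open (open_itv a b).
Proof. apply open_and; [apply open_Rbar_gt | apply open_Rbar_lt]. Qed.

Lemma open_slit_TM (I : R -> Prop) : open I -> open (slit_TM I : TM -> Prop).
Proof.
intros HI.
apply open_ext with
  (fun p : TM => I (fst (fst p)) /\ (fst (snd p) <> 0 \/ snd (snd p) <> 0)).
- intros [[u v] [x y]]; unfold slit_TM, in_TM; simpl.
  split; intros [Hu H]; split; auto.
  + intros E; inversion E; lra.
  + destruct (Req_dec x 0) as [-> |]; [right | now left].
    intros ->; now apply H.
- apply open_and.
  + apply (open_comp (fun p : TM => fst (fst p)) I); [| exact HI].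
    intros p _; apply (continuous_comp (fun p : TM => fst p) fst);
      [apply: continuous_fst | destruct p as [[? ?] ?]; apply: continuous_fst].
  + apply open_or.
    * apply (open_comp (fun p : TM => fst (snd p)) (fun x => x <> 0)); [| apply open_neq].
      intros p _; apply (continuous_comp (fun p : TM => snd p) fst);
        [apply: continuous_snd | apply: continuous_fst].
    * apply (open_comp (fun p : TM => snd (snd p)) (fun x => x <> 0)); [| apply open_neq].
      intros p _; apply (continuous_comp (fun p : TM => snd p) snd);
      [apply: continuous_snd | apply: continuous_snd].
Qed.

(** * The slope norm in a single tangent plane *)

Definition quad_norm (A B x y : R) : R := sqrt (A * x ^ 2 + B * y ^ 2).
Definition slope_norm (A B x y : R) : R := quad_norm A B x y ^ 2 / (quad_norm A B x y - x).
Definition slope_norm_x (A B x y : R) : R :=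
  (A * x * (quad_norm A B x y - 2 * x) + quad_norm A B x y ^ 2) / (quad_norm A B x y - x) ^ 2.
Definition slope_norm_y (A B x y : R) : R :=
  B * y * (quad_norm A B x y - 2 * x) / (quad_norm A B x y - x) ^ 2.

(** The factor [K] in [F_ww = K (x w2 - y w1)^2]. *)
Definition curv (A B x y : R) : R :=
  B * ((A + 2) * quad_norm A B x y - 3 * A * x) / (quad_norm A B x y * (quad_norm A B x y - x) ^ 3).

Section Fibre.
Variables (A B x y : R).
Hypotheses (HA : 1 <= A) (HB : 0 < B) (Hxy : (x, y) <> (0, 0)).

Lemma quad_form_pos : 0 < A * x ^ 2 + B * y ^ 2.
Proof.
destruct (Req_dec x 0) as [-> | Hx].
- assert (y <> 0) by (intros ->; now apply Hxy).
  assert (0 < y ^ 2) by (apply pow2_gt_0; auto); nra.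
- assert (0 < x ^ 2) by (apply pow2_gt_0; auto).
  assert (0 <= y ^ 2) by apply pow2_ge_0; nra.
Qed.

Lemma quad_norm_pos : 0 < quad_norm A B x y.
Proof. apply sqrt_lt_R0, quad_form_pos. Qed.

Lemma quad_norm_sq : quad_norm A B x y ^ 2 = A * x ^ 2 + B * y ^ 2.
Proof. apply pow2_sqrt, Rlt_le, quad_form_pos. Qed.

Lemma is_derive_quad_norm_x : is_derive (fun s => quad_norm A B s y) x (A * x / quad_norm A B x y).
Proof.
generalize quad_form_pos quad_norm_pos; unfold quad_norm; intros Q N.
auto_derive; [auto | simpl; field; simpl in N; lra].
Qed.

Lemma is_derive_quad_norm_y : is_derive (fun s => quad_norm A B x s) y (B * y / quad_norm A B x y).
Proof.
generalize quad_form_pos quad_norm_pos; unfold quad_norm; intros Q N.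
auto_derive; [auto | simpl; field; simpl in N; lra].
Qed.

Hypothesis Hlt : x < quad_norm A B x y.

Ltac deriv H :=
  generalize quad_norm_pos H; intros N D;
  match type of D with is_derive ?f ?x0 ?l =>
    pose proof (is_derive_unique f x0 l D);
    assert (ex_derive f x0) by (eexists; exact D) end.

Lemma is_derive_slope_norm_x : is_derive (fun s => slope_norm A B s y) x (slope_norm_x A B x y).
Proof.
deriv is_derive_quad_norm_x; unfold slope_norm, slope_norm_x; auto_derive.
{ repeat split; auto; lra. }
rewrite H; field; lra.
Qed.

Lemma is_derive_slope_norm_y : is_derive (fun s => slope_norm A B x s) y (slope_norm_y A B x y).
Proof.
deriv is_derive_quad_norm_y; unfold slope_norm, slope_norm_y; auto_derive.
{ repeat split; auto; lra. }
rewrite H; field; lra.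
Qed.

(** The factor [B] of [curv] meets [y ^ 2], and [B y^2 = n^2 - A x^2] turns the
    claim into an identity between rational functions of [n], [A] and [x]. *)
Lemma is_derive_slope_norm_xx : is_derive (fun s => slope_norm_x A B s y) x (curv A B x y * y ^ 2).
Proof.
deriv is_derive_quad_norm_x; unfold slope_norm_x, curv; auto_derive.
{ repeat split; auto; apply Rgt_not_eq; repeat apply Rmult_lt_0_compat; lra. }
rewrite H.
transitivity ((quad_norm A B x y ^ 2 - A * x ^ 2) * ((A + 2) * quad_norm A B x y - 3 * A * x) /
  (quad_norm A B x y * (quad_norm A B x y - x) ^ 3)); [field; lra |].
rewrite quad_norm_sq; field; lra.
Qed.

Lemma is_derive_slope_norm_yx :
  is_derive (fun s => slope_norm_y A B s y) x (- curv A B x y * x * y).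
Proof.
deriv is_derive_quad_norm_x; unfold slope_norm_y, curv; auto_derive.
{ repeat split; auto; apply Rgt_not_eq; repeat apply Rmult_lt_0_compat; lra. }
rewrite H; field; lra.
Qed.

Lemma is_derive_slope_norm_xy :
  is_derive (fun s => slope_norm_x A B x s) y (- curv A B x y * x * y).
Proof.
deriv is_derive_quad_norm_y; unfold slope_norm_x, curv; auto_derive.
{ repeat split; auto; apply Rgt_not_eq; repeat apply Rmult_lt_0_compat; lra. }
rewrite H; field; lra.
Qed.

Lemma is_derive_slope_norm_yy : is_derive (fun s => slope_norm_y A B x s) y (curv A B x y * x ^ 2).
Proof.
deriv is_derive_quad_norm_y; unfold slope_norm_y, curv; auto_derive.
{ repeat split; auto; apply Rgt_not_eq; repeat apply Rmult_lt_0_compat; lra. }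
rewrite H.
(* Differentiating [y n_y] produces [y^2] with a factor [B]; eliminating it brings
   out the factor [x^2]. *)
set (n := quad_norm A B x y) in *.
assert (E : B * (y * y) = n ^ 2 - A * x ^ 2) by (unfold n; rewrite quad_norm_sq; ring).
transitivity (B * (n * (n - 2 * x) * (n - x) + (B * (y * y)) * (3 * x - n)) / (n * (n - x) ^ 3));
  [field; lra | rewrite E; field; lra].
Qed.

End Fibre.

(** * The fundamental tensor of the slope metric *)

Definition angle_independent (G : R -> R -> R -> R) (p : TM) : R :=
  G (fst (fst p)) (fst (snd p)) (snd (snd p)).

Lemma partial_y1_is_derive (G : R -> R -> R -> R) u v x y l :
  is_derive (fun s => G u s y) x l ->
  partial e_y1 (angle_independent G) ((u, v), (x, y)) = l.
Proof.
intros H; apply is_derive_unique.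
apply (is_derive_ext (fun t => G u (x + t) y)).
{ intros t; unfold angle_independent; simpl; unfold plus, scal; simpl; unfold mult; simpl.
  now rewrite !Rmult_0_r Rmult_1_r !Rplus_0_r. }
replace l with (1 * l) by ring.
apply (is_derive_comp (fun s => G u s y)).
- now rewrite Rplus_0_r.
- auto_derive; [easy | ring].
Qed.

Lemma partial_y2_is_derive (G : R -> R -> R -> R) u v x y l :
  is_derive (fun s => G u x s) y l ->
  partial e_y2 (angle_independent G) ((u, v), (x, y)) = l.
Proof.
intros H; apply is_derive_unique.
apply (is_derive_ext (fun t => G u x (y + t))).
{ intros t; unfold angle_independent; simpl; unfold plus, scal; simpl; unfold mult; simpl.
  now rewrite !Rmult_0_r Rmult_1_r !Rplus_0_r. }
replace l with (1 * l) by ring.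
apply (is_derive_comp (fun s => G u x s)).
- now rewrite Rplus_0_r.
- auto_derive; [easy | ring].
Qed.

Lemma is_derive_square (f : R -> R) z l :
  is_derive f z l -> is_derive (fun s => f s ^ 2) z (2 * (f z * l)).
Proof.
intros H; replace (2 * (f z * l)) with (INR 2 * l * f z ^ 1) by (simpl; ring).
now apply is_derive_pow.
Qed.

Lemma is_derive_double_mult (f g : R -> R) z l k :
  is_derive f z l -> is_derive g z k ->
  is_derive (fun s => 2 * (f s * g s)) z (2 * (l * g z + f z * k)).
Proof.
intros Hf Hg; apply: is_derive_scal.
exact (is_derive_mult f g z l k Hf Hg Rmult_comm).
Qed.

Section Tensor.
Variables (I : R -> Prop) (m : R -> R).
Hypothesis HI : open I.
Hypothesis Hm : forall u, I u -> 0 < m u.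
Hypothesis Hlt : forall p, slit_TM I p -> beta p < alpha m p.

Local Notation A u := (1 + Derive m u ^ 2).
Local Notation B u := (m u ^ 2).

Lemma coef_du_ge_1 u : 1 <= A u.
Proof. generalize (pow2_ge_0 (Derive m u)); lra. Qed.

Lemma coef_dv_pos u : I u -> 0 < B u.
Proof. intros Hu; apply pow_lt; auto. Qed.

Lemma lt_quad_norm u x y : I u -> (x, y) <> (0, 0) -> x < quad_norm (A u) (B u) x y.
Proof. intros Hu Hxy; exact (Hlt ((u, 0), (x, y)) (conj Hu Hxy)). Qed.

Lemma partial_y1_square q : slit_TM I q ->
  partial e_y1 (fun q => slope_metric m q ^ 2) q =
  angle_independent (fun u x y => 2 * (slope_norm (A u) (B u) x y * slope_norm_x (A u) (B u) x y)) q.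
Proof.
destruct q as [[u v] [x y]]; intros [Hu Hxy]; unfold in_TM in Hu; simpl in Hu, Hxy.
transitivity (partial e_y1 (angle_independent (fun u x y => slope_norm (A u) (B u) x y ^ 2))
  ((u, v), (x, y))).
{ apply Derive_ext; intros t; reflexivity. }
apply (partial_y1_is_derive (fun u x y => slope_norm (A u) (B u) x y ^ 2)),
  (is_derive_square (fun s => slope_norm (A u) (B u) s y)).
apply is_derive_slope_norm_x; auto using coef_du_ge_1, coef_dv_pos, lt_quad_norm.
Qed.

Lemma partial_y2_square q : slit_TM I q ->
  partial e_y2 (fun q => slope_metric m q ^ 2) q =
  angle_independent (fun u x y => 2 * (slope_norm (A u) (B u) x y * slope_norm_y (A u) (B u) x y)) q.
Proof.
destruct q as [[u v] [x y]]; intros [Hu Hxy]; unfold in_TM in Hu; simpl in Hu, Hxy.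
transitivity (partial e_y2 (angle_independent (fun u x y => slope_norm (A u) (B u) x y ^ 2))
  ((u, v), (x, y))).
{ apply Derive_ext; intros t; reflexivity. }
apply (partial_y2_is_derive (fun u x y => slope_norm (A u) (B u) x y ^ 2)),
  (is_derive_square (fun s => slope_norm (A u) (B u) x s)).
apply is_derive_slope_norm_y; auto using coef_du_ge_1, coef_dv_pos, lt_quad_norm.
Qed.

(** From [g = F_w^2 + F F_ww] and the formulas for the second derivatives.  The
    inner partial derivatives are replaced by their closed forms on the whole
    open set [slit_TM I] before the outer ones are taken. *)
Lemma fundamental_tensor_sum_of_squares u v x y w1 w2 : I u -> (x, y) <> (0, 0) ->
  let p := ((u, v), (x, y)) in let F := slope_metric m in
  fundamental_tensor F e_y1 e_y1 p * w1 * w1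
  + fundamental_tensor F e_y1 e_y2 p * w1 * w2
  + fundamental_tensor F e_y2 e_y1 p * w2 * w1
  + fundamental_tensor F e_y2 e_y2 p * w2 * w2 =
  (slope_norm_x (A u) (B u) x y * w1 + slope_norm_y (A u) (B u) x y * w2) ^ 2
  + slope_norm (A u) (B u) x y * curv (A u) (B u) x y * (x * w2 - y * w1) ^ 2.
Proof.
intros Hu Hxy p F.
assert (HD : open (slit_TM I : TM -> Prop)) by now apply open_slit_TM.
assert (Hp : slit_TM I p) by now split.
assert (HA := coef_du_ge_1 u); assert (HB := coef_dv_pos u Hu).
assert (HL := lt_quad_norm u x y Hu Hxy).
unfold fundamental_tensor, F.
rewrite !(partial_ext_open _ _ _ p _ HD Hp partial_y1_square).
rewrite !(partial_ext_open _ _ _ p _ HD Hp partial_y2_square).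
unfold p.
rewrite (partial_y1_is_derive
  (fun u x y => 2 * (slope_norm (A u) (B u) x y * slope_norm_x (A u) (B u) x y))
  u v x y _ (is_derive_double_mult _ _ x _ _
  (is_derive_slope_norm_x _ _ _ _ HA HB Hxy HL) (is_derive_slope_norm_xx _ _ _ _ HA HB Hxy HL))).
rewrite (partial_y1_is_derive
  (fun u x y => 2 * (slope_norm (A u) (B u) x y * slope_norm_y (A u) (B u) x y))
  u v x y _ (is_derive_double_mult _ _ x _ _
  (is_derive_slope_norm_x _ _ _ _ HA HB Hxy HL) (is_derive_slope_norm_yx _ _ _ _ HA HB Hxy HL))).
rewrite (partial_y2_is_derive
  (fun u x y => 2 * (slope_norm (A u) (B u) x y * slope_norm_x (A u) (B u) x y))
  u v x y _ (is_derive_double_mult _ _ y _ _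
  (is_derive_slope_norm_y _ _ _ _ HA HB Hxy HL) (is_derive_slope_norm_xy _ _ _ _ HA HB Hxy HL))).
rewrite (partial_y2_is_derive
  (fun u x y => 2 * (slope_norm (A u) (B u) x y * slope_norm_y (A u) (B u) x y))
  u v x y _ (is_derive_double_mult _ _ y _ _
  (is_derive_slope_norm_y _ _ _ _ HA HB Hxy HL) (is_derive_slope_norm_yy _ _ _ _ HA HB Hxy HL))).
field.
Qed.

End Tensor.

(** * The sign of the curvature factor *)

Section Convexity.
Variables (A B x y : R).
Hypotheses (HA : 4 < A) (HB : 0 < B) (Hxy : (x, y) <> (0, 0)).

Let N : 0 < quad_norm A B x y.
Proof. apply quad_norm_pos; auto; lra. Qed.

Let Q : quad_norm A B x y ^ 2 = A * x ^ 2 + B * y ^ 2.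
Proof. apply quad_norm_sq; auto; lra. Qed.

Lemma lt_quad_norm_of_gt_4 : x < quad_norm A B x y.
Proof.
destruct (Rle_lt_dec x 0) as [Hx | Hx]; [lra |].
destruct (Rlt_le_dec x (quad_norm A B x y)) as [| H]; [easy |].
assert (0 <= y ^ 2) by apply pow2_ge_0; nra.
Qed.

(** For [x > 0], squaring [(A + 2) n > 3 A x] and using [n^2 >= A x^2] leaves
    [(A + 2)^2 > 9 A], that is [(A - 1) (A - 4) > 0]. *)
Lemma curv_pos_of_gt_4 : 0 < curv A B x y.
Proof.
generalize lt_quad_norm_of_gt_4; intros L.
apply Rdiv_lt_0_compat.
2: { apply Rmult_lt_0_compat; [exact N | apply pow_lt; lra]. }
apply Rmult_lt_0_compat; [exact HB |].
destruct (Rle_lt_dec x 0) as [Hx | Hx]; [nra |].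
set (n := quad_norm A B x y) in *.
destruct (Rlt_le_dec (3 * A * x) ((A + 2) * n)) as [| H]; [lra |].
assert (S : ((A + 2) * n) ^ 2 <= (3 * A * x) ^ 2) by (apply pow_incr; split; [nra | easy]).
assert (E : ((A + 2) * n) ^ 2 = (A + 2) ^ 2 * (A * x ^ 2 + B * y ^ 2)) by (rewrite -Q; ring).
assert (0 <= (A + 2) ^ 2 * (B * y ^ 2)).
{ apply Rmult_le_pos; [apply pow2_ge_0 |]; apply Rmult_le_pos; [lra | apply pow2_ge_0]. }
assert (0 < (A - 1) * (A - 4) * (A * x ^ 2)).
{ repeat apply Rmult_lt_0_compat; lra. }
nra.
Qed.

Lemma slope_norm_pos : 0 < slope_norm A B x y.
Proof.
generalize lt_quad_norm_of_gt_4; intros L.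
apply Rdiv_lt_0_compat; [apply pow_lt, N | lra].
Qed.

Lemma slope_norm_euler : slope_norm_x A B x y * x + slope_norm_y A B x y * y = slope_norm A B x y.
Proof.
generalize lt_quad_norm_of_gt_4; intros L; unfold slope_norm_x, slope_norm_y, slope_norm.
set (n := quad_norm A B x y) in *.
transitivity (((A * x ^ 2 + B * y ^ 2) * (n - 2 * x) + n ^ 2 * x) / (n - x) ^ 2);
  [field; lra | rewrite -Q; field; lra].
Qed.

(** By Euler, if [w] is proportional to [(x, y)] then the first square is
    nonzero unless [w = 0]; otherwise the second square is nonzero. *)
Lemma square_sum_pos w1 w2 : (w1, w2) <> (0, 0) ->
  0 < (slope_norm_x A B x y * w1 + slope_norm_y A B x y * w2) ^ 2
      + slope_norm A B x y * curv A B x y * (x * w2 - y * w1) ^ 2.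
Proof.
intros Hw.
set (L := slope_norm_x A B x y * w1 + slope_norm_y A B x y * w2).
assert (K : 0 < slope_norm A B x y * curv A B x y).
{ apply Rmult_lt_0_compat; [apply slope_norm_pos | apply curv_pos_of_gt_4]. }
destruct (Req_dec (x * w2 - y * w1) 0) as [E | E].
- assert (HL : L <> 0).
  { intros HL; apply Hw.
    assert (H1 : slope_norm A B x y * w1 = 0).
    { rewrite -slope_norm_euler.
      transitivity (L * x - slope_norm_y A B x y * (x * w2 - y * w1));
        [unfold L; ring | rewrite HL E; ring]. }
    assert (H2 : slope_norm A B x y * w2 = 0).
    { rewrite -slope_norm_euler.
      transitivity (L * y + slope_norm_x A B x y * (x * w2 - y * w1));
        [unfold L; ring | rewrite HL E; ring]. }
    generalize slope_norm_pos; intros P.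
    apply Rmult_integral in H1; apply Rmult_integral in H2; f_equal; lra. }
  rewrite E; generalize (pow2_gt_0 L HL); lra.
- generalize (pow2_gt_0 _ E) (pow2_ge_0 L); nra.
Qed.

End Convexity.

(** At [(1, 0)] one has [n^2 = A], so [(A + 2) n - 3 A = n (n - 1) (n - 2)]: given
    [n > 1], positivity forces [n > 2]. *)
Lemma gt_4_of_meridian_curv_pos A B :
  1 <= A -> 0 < B -> 1 < quad_norm A B 1 0 -> 0 < slope_norm A B 1 0 * curv A B 1 0 -> 4 < A.
Proof.
intros HA HB; unfold slope_norm, curv.
assert (Q : quad_norm A B 1 0 ^ 2 = A).
{ rewrite quad_norm_sq //; [ring | intros E; inversion E; lra]. }
set (n := quad_norm A B 1 0) in *; intros Hn H.
destruct (Rlt_le_dec 4 A) as [| HA4]; [easy |].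
assert (n <= 2) by nra.
assert (E : n ^ 2 / (n - 1) * (B * ((A + 2) * n - 3 * A * 1) / (n * (n - 1) ^ 3))
  = - (B * n ^ 2 * (2 - n) / (n - 1) ^ 3)) by (rewrite -Q; field; lra).
assert (0 <= B * n ^ 2 * (2 - n) / (n - 1) ^ 3).
{ apply Rdiv_le_0_compat; [| apply pow_lt; lra].
  apply Rmult_le_pos; [apply Rmult_le_pos; [lra | apply pow2_ge_0] | lra]. }
lra.
Qed.

(** Necessity tests the tensor at the meridian direction [(1, 0)] on the
    transverse vector [(0, 1)]: there [F_y = 0], so only the curvature term is left. *)
Lemma strongly_convex_slope_metric_iff (I : R -> Prop) (m : R -> R) :
  open I -> (forall u, I u -> 0 < m u) ->
  (strongly_convex_slope_metric I m <-> forall u, I u -> Derive m u ^ 2 > 3).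
Proof.
intros HI Hm; split.
- intros [Hlt Hc] u Hu.
  assert (H10 : (1, 0) <> (0, 0)) by (intros E; inversion E; lra).
  assert (H01 : (0, 1) <> (0, 0)) by (intros E; inversion E; lra).
  destruct (Hc ((u, 0), (1, 0)) (conj Hu H10)) as [_ Hpd].
  specialize (Hpd 0 1 H01).
  rewrite (fundamental_tensor_sum_of_squares I m HI Hm Hlt u 0 1 0 0 1 Hu H10) in Hpd.
  assert (4 < 1 + Derive m u ^ 2); [| lra].
  apply (gt_4_of_meridian_curv_pos _ (m u ^ 2)).
  + apply coef_du_ge_1.
  + now apply (coef_dv_pos I).
  + now apply (lt_quad_norm I m Hlt).
  + unfold slope_norm_y in Hpd; unfold Rdiv in Hpd; rewrite !Rmult_0_r !Rmult_0_l in Hpd.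
    unfold slope_norm_y in Hpd; lra.
- intros H3.
  assert (Hlt : forall p, slit_TM I p -> beta p < alpha m p).
  { intros [[u v] [x y]] [Hu Hxy].
    apply (lt_quad_norm_of_gt_4 (1 + Derive m u ^ 2) (m u ^ 2) x y); auto.
    - generalize (H3 u Hu); lra.
    - now apply (coef_dv_pos I). }
  split; [exact Hlt |].
  intros [[u v] [x y]] [Hu Hxy].
  assert (HA : 4 < 1 + Derive m u ^ 2) by (generalize (H3 u Hu); lra).
  assert (HB : 0 < m u ^ 2) by now apply (coef_dv_pos I).
  split; [now apply slope_norm_pos |].
  intros w1 w2 Hw; rewrite (fundamental_tensor_sum_of_squares I m HI Hm Hlt u v x y w1 w2 Hu Hxy).
  now apply square_sum_pos.
Qed.

(** * The Finsler structure *)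

Lemma elementary_square {V : NormedModule R_AbsRing} (D : V -> Prop) f :
  elementary D f -> elementary D (fun p => f p ^ 2).
Proof.
intros Hf; now do 2 (apply elementary_mult; [assumption |]); constructor.
Qed.

Lemma slope_metric_smooth (I : R -> Prop) (m : R -> R) :
  open I -> smooth_on_R I m -> (forall u, I u -> 0 < m u) ->
  (forall p, slit_TM I p -> beta p < alpha m p) ->
  smooth_on (slit_TM I) (slope_metric m).
Proof.
intros HI Hs Hm Hlt.
set (D := slit_TM I : TM -> Prop).
set (lu := fun p : TM => fst (fst p)).
set (lx := fun p : TM => fst (snd p)).
set (ly := fun p : TM => snd (snd p)).
assert (Hlu : is_linear lu) by exact (is_linear_comp _ _ is_linear_fst is_linear_fst).
assert (Hlx : is_linear lx) by exact (is_linear_comp _ _ is_linear_snd is_linear_fst).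
assert (Hly : is_linear ly) by exact (is_linear_comp _ _ is_linear_snd is_linear_snd).
assert (Eu := elementary_linear D lu Hlu).
assert (Ex := elementary_linear D lx Hlx).
assert (Ey := elementary_linear D ly Hly).
assert (Em : elementary D (fun p => m (lu p))).
{ apply elementary_comp; [| exact Eu]; intros p n [Hu _]; now apply Hs. }
assert (Edm : elementary D (fun p => Derive m (lu p))).
{ apply (elementary_comp D (Derive m)); [| exact Eu]; intros p n [Hu _].
  now apply ex_derive_n_Derive, Hs. }
set (Q := fun p => (1 + Derive m (lu p) ^ 2) * lx p ^ 2 + m (lu p) ^ 2 * ly p ^ 2).
assert (EQ : elementary D Q).
{ repeat (apply elementary_plus || apply elementary_mult || apply elementary_square);
    auto; constructor. }
assert (HQ : forall p, D p -> 0 < Q p).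
{ intros [[u v] [x y]] [Hu Hxy]; apply (quad_form_pos (1 + Derive m u ^ 2) (m u ^ 2)); auto.
  - apply coef_du_ge_1.
  - now apply (coef_dv_pos I). }
assert (Ea : elementary D (fun p => sqrt (Q p))) by now apply elementary_sqrt.
assert (Hd : forall p, D p -> sqrt (Q p) + -1 * lx p <> 0).
{ intros [[u v] [x y]] Hp; generalize (Hlt _ Hp); unfold beta, alpha, Q, lu, lx, ly; simpl; lra. }
apply (elementary_smooth D _ (fun p => Q p * / (sqrt (Q p) + -1 * lx p))).
- now apply open_slit_TM.
- apply elementary_mult; [exact EQ |].
  apply elementary_inv; [exact Hd |].
  apply elementary_plus; [exact Ea |].
  apply elementary_mult; [constructor | exact Ex].
- intros p Hp; generalize (HQ p Hp).
  destruct p as [[u v] [x y]]; unfold slope_metric, alpha, beta.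
  change (0 < Q ((u, v), (x, y)) -> sqrt (Q ((u, v), (x, y))) ^ 2 / (sqrt (Q ((u, v), (x, y))) - x)
    = Q ((u, v), (x, y)) * / (sqrt (Q ((u, v), (x, y))) + -1 * x)).
  intros HQp; rewrite pow2_sqrt; [| lra].
  unfold Rdiv; do 2 f_equal; ring.
Qed.

Lemma slope_metric_homogeneous m (q y : R * R) l :
  0 < l -> slope_metric m (q, scal l y) = l * slope_metric m (q, y).
Proof.
intros Hl.
assert (Ea : alpha m (q, scal l y) = l * alpha m (q, y)).
{ destruct q as [u v], y as [x y]; simpl; unfold scal; simpl; unfold mult; simpl.
  transitivity (sqrt (l * l * ((1 + Derive m u ^ 2) * x ^ 2 + m u ^ 2 * y ^ 2))).
  - f_equal; ring.
  - rewrite sqrt_mult_alt; [rewrite sqrt_square //; lra | nra]. }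
assert (Eb : beta (q, scal l y) = l * beta (q, y)) by (destruct q, y; reflexivity).
unfold slope_metric; rewrite Ea Eb -Rmult_minus_distr_l /Rdiv Rinv_mult.
(* No case split on [alpha = beta] at the zero vector: [/ (l * z) = / l * / z]
   holds for every [z]. *)
set (d := / (alpha m (q, y) - beta (q, y))).
transitivity (l * (l * / l) * (alpha m (q, y) ^ 2 * d)); [ring | field; lra].
Qed.

Theorem theorem4p7 (a b : Rbar) (m : R -> R)
  (hab : Rbar_lt a b)
  (hm_smooth : smooth_on_R (open_itv a b) m)
  (hm_pos : forall u : R, open_itv a b u -> 0 < m u) :
  (strongly_convex_slope_metric (open_itv a b) m <->
   (forall u : R, open_itv a b u -> Derive m u ^ 2 > 3)) /\
  (strongly_convex_slope_metric (open_itv a b) m ->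
   finsler_surface_of_revolution (open_itv a b) (slope_metric m)).
Proof.
split; [apply strongly_convex_slope_metric_iff; [apply open_open_itv | exact hm_pos] |].
intros [Hlt Hc]; split.
- split; [intros u v x y _; reflexivity |].
  split; [apply slope_metric_smooth; auto using open_open_itv |].
  split; [| exact Hc].
  intros q y l _; apply slope_metric_homogeneous.
- intros [[u v] [x y]] _.
  assert (E : forall t, slope_metric m (plus ((u, v), (x, y)) (scal t e_v))
                        = slope_metric m ((u, v), (x, y))).
  { intros t.
    change (slope_metric m ((u + t * 0, v + t * 1), (x + t * 0, y + t * 0))
            = slope_metric m ((u, v), (x, y))).
    now rewrite !Rmult_0_r !Rplus_0_r. }
  assert (D : is_derive (fun t => slope_metric m (plus ((u, v), (x, y)) (scal t e_v))) 0 0).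
  { apply (is_derive_ext (fun _ => slope_metric m ((u, v), (x, y)))); [now symmetry |].
    apply: is_derive_const. }
  split; [now exists 0 | now apply is_derive_unique].
Qed.
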